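(* Let $f$ be a GNN model with $r$ layers and $C$ output classes, let $\mathcal{G}_C$ be a clean attributed graph, let $v$ be a node of it, and let $\mathcal{T}$ be a trigger, i.e. a finite set of structural or feature perturbation components within the $r$-hop neighborhood of $v$. For $S\subseteq\mathcal{T}$ let $\Delta_H(S)=H_v(\mathcal{G}_C\oplus\mathsf{do}(S))-H_v(\mathcal{G}_C)\in\mathbb{R}^C$ be the influence of $S$ on the logits of $v$, and let $EI(\mathcal{T})$ and $IC(\mathcal{T})$ be the External Influence and Internal Correlation of $\mathcal{T}$, i.e. the sums of the Harsanyi dividends of $\Delta_H$ over the subsets of $\mathcal{T}$ of size $1$ and of size at least $2$, respectively. Let $\Theta_{\text{detectable}}>0$ be a constant. If $$\|\Delta_H(\mathcal{T})\|_2\ \ge\ \Theta_{\text{detectable}},$$ then $$\|EI(\mathcal{T})\|_2\ \ge\ \tfrac12\,\Theta_{\text{detectable}}\qquad\text{or}\qquad \|IC(\mathcal{T})\|_2\ \ge\ \tfrac12\,\Theta_{\text{detectable}}.$$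
   Context: Setting. For a graph $\mathcal{G}$ (with node features), the model $f$ computes a logit vector $H_v(\mathcal{G})\in\mathbb{R}^C$ for the node $v$; no further property of $f$ is used beyond $H_v$ being a function from attributed graphs to $\mathbb{R}^C$. Intervention. For a set $S$ of perturbation components in the $r$-hop neighborhood of $v$, $\mathcal{G}_C\oplus\mathsf{do}(S)$ denotes the graph obtained from $\mathcal{G}_C$ by applying the perturbation $S$ (adding $S$ if it is absent, removing it if it is present). Applying the empty set changes nothing, so $\Delta_H(\emptyset)=\mathbf{0}$. Thus $S\mapsto\Delta_H(S)$ is a set function $2^{\mathcal{T}}\to\mathbb{R}^C$ vanishing at $\emptyset$. Harsanyi dividends. The dividends $\Phi_S\in\mathbb{R}^C$, $S\subseteq\mathcal{T}$, are defined recursively by $$\Phi_S=\Delta_H(S)-\sum_{R\subsetneq S}\Phi_R ,$$ so in particular $\Phi_\emptyset=\mathbf{0}$. External Influence and Internal Correlation: $$EI(\mathcal{T})=\sum_{t\in\mathcal{T}}\Phi_{\{t\}},\qquad IC(\mathcal{T})=\sum_{\substack{S\subseteq\mathcal{T}\\ |S|\ge 2}}\Phi_S .$$ $\|\cdot\|_2$ is the Euclidean norm on $\mathbb{R}^C$. *)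

(* Defs.v *)
From mathcomp Require Import all_boot all_order all_algebra.
From mathcomp Require Import finmap reals.

Set Implicit Arguments.
Unset Strict Implicit.
Unset Printing Implicit Defensive.

Import Order.TTheory GRing.Theory Num.Theory.
Local Open Scope ring_scope.

(* The entry norm that MathComp-Analysis puts on matrices is the sup norm,
   hence an explicit Euclidean norm. *)
Definition norm2 (R : realType) (C : nat) (x : 'rV[R]_C) : R :=
  Num.sqrt (\sum_(i < C) x 0 i ^+ 2).

Section HarsanyiDividends.
Variables (K : choiceType) (W : zmodType).
Implicit Types (D : {fset K} -> W) (S T : {fset K}).

(* [n] is a recursion fuel; any [n >= #|` S|] is enough (see [dividendE]). *)
Fixpoint dividend_rec (n : nat) D S : W :=
  if n is n'.+1 then
    D S - \sum_(R <- fpowerset S | (R `<` S)%fset) dividend_rec n' D R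
  else D S.

Definition dividend D S : W := dividend_rec #|` S| D S.

Definition external_influence D T : W :=
  \sum_(t <- T) dividend D [fset t]%fset.

Definition internal_correlation D T : W :=
  \sum_(S <- fpowerset T | (2 <= #|` S|)%N) dividend D S.

Lemma dividend_rec_fuel D S n m :
  (#|` S| <= n)%N -> (#|` S| <= m)%N -> dividend_rec n D S = dividend_rec m D S.
Proof.
elim: n m S => [|n IHn] [|m] S //=.
- rewrite leqn0 cardfs_eq0 => /eqP -> _; rewrite big1 ?subr0 // => R.
  by move=> /fproper_ltn_card; rewrite cardfs0.
- move=> _; rewrite leqn0 cardfs_eq0 => /eqP ->; rewrite big1 ?subr0 // => R.
  by move=> /fproper_ltn_card; rewrite cardfs0.
move=> Sn Sm; congr (_ - _); apply: eq_bigr => R /fproper_ltn_card RS.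
by apply: IHn; rewrite -ltnS (leq_trans RS).
Qed.

Lemma dividendE D S :
  dividend D S = D S - \sum_(R <- fpowerset S | (R `<` S)%fset) dividend D R.
Proof.
rewrite {1}/dividend (@dividend_rec_fuel D S _ #|` S|.+1) //=.
congr (_ - _); apply: eq_bigr => R /fproper_ltn_card RS.
by apply: dividend_rec_fuel => //; apply: ltnW.
Qed.

End HarsanyiDividends.

Section AttributedGraphs.
Variables (R : realType) (V : finType) (d : nat).

Definition vpair : finType := {e : {set V} | #|e| == 2}.

(* [V] is a universe of node names: it contains the nodes of the clean graph
   and those that a trigger may inject. Graphs are simple and undirected. *)
Record attributed_graph := AttributedGraph {
  nodes : {set V};
  edges : {set vpair};
  feat : {ffun V -> 'rV[R]_d};
  edges_nodes : [forall e in edges, val e \subset nodes];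
  feat_nodes : [forall u, (u \notin nodes) ==> (feat u == 0)]
}.

Implicit Types (G : attributed_graph) (u v : V).

Definition adj G : rel V :=
  fun x y => [exists e in edges G, val e == [set x; y]].

(* The nodes at distance at most [r] from [v]. *)
Fixpoint hop_nbhd (e : rel V) (r : nat) v : {set V} :=
  if r is r'.+1 then
    let B := hop_nbhd e r' v in B :|: [set y | [exists x in B, e x y]]
  else [set v].

Definition component : Type := (V + vpair + V * 'rV[R]_d)%type.

Definition node_component u : component := inl (inl u).
Definition edge_component (e : vpair) : component := inl (inr e).
Definition feat_component u (delta : 'rV[R]_d) : component := inr (u, delta).

Definition component_nodes (c : component) : {set V} :=
  match c with
  | inl (inl u) => [set u]
  | inl (inr e) => val e
  | inr (u, _) => [set u]
  end.

(* A feature component is present when the features of its node agree with it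
   on its support. For binary features and [delta] a unit vector, adding an
   absent component and removing a present one is the flip of one bit. *)
Definition feat_present G u (delta : 'rV[R]_d) : bool :=
  [forall j, (delta 0 j != 0) ==> (feat G u 0 j == delta 0 j)].

Definition feat_shift G u (c : component) : 'rV[R]_d :=
  if c is inr (w, delta) then
    if w == u then (if feat_present G u delta then - delta else delta) else 0
  else 0.

Section Intervention.
Variables (G : attributed_graph) (S : {fset component}).

Definition do_nodes : {set V} :=
  [set u | (u \in nodes G) (+) (node_component u \in S)].

(* An edge lives only between two nodes of the resulting graph; in particular
   removing a node removes its edges. *)
Definition do_edges : {set vpair} :=
  [set e : vpair | ((e \in edges G) (+) (edge_component e \in S))
                   && (val e \subset do_nodes)].

Definition do_feat : {ffun V -> 'rV[R]_d} :=
  [ffun u => if u \in do_nodes then feat G u + \sum_(c <- S) feat_shift G u c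
             else 0].

Lemma do_edges_nodes : [forall e in do_edges, val e \subset do_nodes].
Proof. by apply/forall_inP => e; rewrite inE => /andP[]. Qed.

Lemma do_feat_nodes : [forall u, (u \notin do_nodes) ==> (do_feat u == 0)].
Proof. by apply/forall_inP => u /negPf u'; rewrite ffunE u'. Qed.

Definition intervene : attributed_graph :=
  AttributedGraph do_edges_nodes do_feat_nodes.

End Intervention.

Lemma attributed_graph_eq G G' :
  nodes G = nodes G' -> edges G = edges G' -> feat G = feat G' -> G = G'.
Proof.
case: G G' => [N E X HE HX] [N' E' X' HE' HX'] /= eN eE eX.
by subst; congr AttributedGraph; apply: bool_irrelevance.
Qed.

Lemma intervene0 G : intervene G fset0 = G.
Proof.
have eN : do_nodes G fset0 = nodes G by apply/setP => u; rewrite !inE addbF.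
apply: attributed_graph_eq => //=.
  apply/setP => e; rewrite !inE addbF eN; apply: andb_idr => eE.
  exact: (forall_inP (edges_nodes G)).
apply/ffunP => u; rewrite ffunE eN big_seq_fset0 addr0; case: ifPn => // uN.
by apply/esym/eqP; exact: (forall_inP (feat_nodes G)).
Qed.

(* Hops are counted along the edges of the clean or of the perturbed graph, so
   that components reaching [v] through edges or nodes that the trigger itself
   injects are allowed. The [r]-hop neighborhood of [v] in the clean graph is
   included in this one. *)
Definition trigger_within (r : nat) G v (T : {fset component}) : Prop :=
  let e := fun x y => adj G x y || adj (intervene G T) x y in
  {in T, forall c, component_nodes c \subset hop_nbhd e r v}.

(* A model is any function giving the logits of the nodes of a graph; no
   locality or architecture is imposed on it. *)
Definition gnn_model (C : nat) := attributed_graph -> V -> 'rV[R]_C.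

Definition influence (C : nat) (f : gnn_model C) G v (S : {fset component}) :
    'rV[R]_C :=
  f (intervene G S) v - f G v.

Lemma influence0 C (f : gnn_model C) G v : influence f G v fset0 = 0.
Proof. by rewrite /influence intervene0 subrr. Qed.

End AttributedGraphs.

(* Main.v *)
Require Import Defs.
From mathcomp Require Import all_boot all_order all_algebra.
From mathcomp Require Import finmap reals.
From mathcomp Require Import lra.

Import Order.TTheory GRing.Theory Num.Theory.
Local Open Scope ring_scope.

(** By Moebius inversion the dividends of all subsets of [T] add up to the
    influence of [T]; since the empty set has dividend 0, the influence is
    EI + IC. If both had norm less than half the threshold, then
    [|x + y|^2 <= 2 (|x|^2 + |y|^2)] would put the norm of the influence below
    the threshold. *)

Section DividendSums.
Variables (K : choiceType) (W : zmodType).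
Implicit Types (D : {fset K} -> W) (T : {fset K}).

Lemma sum_dividend D T : \sum_(S <- fpowerset T) dividend D S = D T.
Proof.
rewrite (bigD1_seq T) ?fset_uniq ?fpowersetE //= [dividend D T]dividendE.
have -> : \sum_(S <- fpowerset T | S != T) dividend D S
        = \sum_(S <- fpowerset T | (S `<` T)%fset) dividend D S.
  rewrite big_seq_cond [RHS]big_seq_cond; apply: eq_bigl => S.
  by rewrite fpowersetE fproperEneq; case: fsubset => //=; rewrite andbT.
by rewrite subrK.
Qed.

(** Reindexes the size-one part of a sum over [fpowerset T] by the elements of [T], the form used in
    [external_influence]. *)
Lemma fpowerset_card1 T :
  @perm_eq {fset K} [seq S <- fpowerset T | #|` S| == 1%N]
                    [seq [fset t]%fset | t <- T].
Proof.
apply: uniq_perm; first by rewrite filter_uniq ?fset_uniq.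
  by rewrite map_inj_uniq ?fset_uniq //; apply: fset1_inj.
move=> S; rewrite mem_filter fpowersetE; apply/andP/mapP.
  by case=> /cardfs1P[t ->]; rewrite fsub1set => tT; exists t.
by case=> t tT ->; rewrite cardfs1 fsub1set.
Qed.

Lemma external_internal D T : D fset0 = 0 ->
  D T = external_influence D T + internal_correlation D T.
Proof.
move=> D0; rewrite -sum_dividend (bigID (fun S => (2 <= #|` S|)%N)) /= addrC.
congr (_ + _); rewrite (bigID (fun S => #|` S| == 1%N)) /=.
(* What remains has size neither at least 2 nor 1, so only [fset0] is left. *)
rewrite [X in _ + X]big1 ?addr0 => [|S]; last first.
  rewrite -ltnNge ltnS => /andP[S1 SN1].
  have /eqP : #|` S| = 0%N by case: #|` S| S1 SN1 => [|[]].
  rewrite cardfs_eq0 => /eqP ->.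
  (* [sum_dividend] at [fset0] has a single term, so the dividend there is [D fset0]. *)
  by rewrite -[RHS]D0 -[RHS]sum_dividend fpowerset0 big_seq_fset1.
rewrite /external_influence.
rewrite -(big_map (fun t => [fset t]%fset) xpredT (dividend D)).
rewrite -(perm_big _ (fpowerset_card1 T)) /= big_filter; apply: eq_bigl => S.
by case: #|` S| => [|[]].
Qed.

End DividendSums.

Section EuclideanNorm.
Variables (R : realType) (C : nat).
Implicit Types x y : 'rV[R]_C.

Lemma norm2_ge0 x : 0 <= norm2 x.
Proof. exact: sqrtr_ge0. Qed.

Lemma sqr_norm2 x : norm2 x ^+ 2 = \sum_(i < C) x 0 i ^+ 2.
Proof. by rewrite sqr_sqrtr // sumr_ge0 // => i _; apply: sqr_ge0. Qed.

(** Entrywise, the right side exceeds the left by [(x 0 i - y 0 i) ^+ 2]; this replaces the triangle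
    inequality and so avoids Cauchy-Schwarz. *)
Lemma sqr_norm2D x y :
  norm2 (x + y) ^+ 2 <= 2 * (norm2 x ^+ 2 + norm2 y ^+ 2).
Proof.
rewrite !sqr_norm2 -big_split mulr_sumr; apply: ler_sum => i _ /=.
by rewrite mxE; have := sqr_ge0 (x 0 i - y 0 i); nra.
Qed.

End EuclideanNorm.

Theorem theoremQ2 (R : realType) (V : finType) (d C r : nat)
    (f : gnn_model R V d C) (G : attributed_graph R V d)
    (v : V) (hv : v \in nodes G)
    (T : {fset component R V d}) (hT : trigger_within r G v T)
    (Theta_detectable : R) (hTheta : 0 < Theta_detectable) :
  Theta_detectable <= norm2 (influence f G v T) ->
  1 / 2 * Theta_detectable <= norm2 (external_influence (influence f G v) T)
  \/ 1 / 2 * Theta_detectable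
     <= norm2 (internal_correlation (influence f G v) T).
Proof.
rewrite (external_internal _ _ _ _ (influence0 f G v)).
set x := external_influence _ _; set y := internal_correlation _ _ => le_xy.
have [|ltx] := leP (1 / 2 * Theta_detectable) (norm2 x); first by left.
have [|lty] := leP (1 / 2 * Theta_detectable) (norm2 y); first by right.
have := sqr_norm2D _ _ x y; rewrite leNgt => /negP[].
(* Nonnegativity allows squaring the strict bounds: with [t] the threshold, [2 * (a ^+ 2 + b ^+ 2) <
   2 * (t ^+ 2 / 4 + t ^+ 2 / 4) = t ^+ 2 <= c ^+ 2]. *)
have := norm2_ge0 _ _ x; have := norm2_ge0 _ _ y.
move: (norm2 x) (norm2 y) (norm2 (x + y)) le_xy ltx lty => a b c; nra.
Qed.
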